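(* Let $(X,d)$ be a non-empty metric space and let $f:X\to X$ be a continuous map, with Zadeh extension $\hat f:\mathcal{F}(X)\to\mathcal{F}(X)$. Then: (a) For each metric $\rho\in\{d_0,d_S,d_E\}$ on $\mathcal{F}(X)$, the dynamical system $((\mathcal{F}(X),\rho),\hat f)$ is contractive if and only if the map $f$ is constant. (b) For each metric $\rho\in\{d_0,d_S,d_E\}$ on $\mathcal{F}(X)$ and for each of the three properties ''expansive'', ''expanding'' and ''positively expansive'', the dynamical system $((\mathcal{F}(X),\rho),\hat f)$ has that property if and only if the set $X$ is a singleton.
   Context: Write $\mathbb{I}=[0,1]$, $\mathbb{N}_0=\{0,1,2,\dots\}$. For a metric space $(X,d)$, the Hausdorff distance between non-empty closed sets $C_1,C_2\subset X$ is $d_H(C_1,C_2)=\max\{\sup_{x_1\in C_1}d(x_1,C_2),\sup_{x_2\in C_2}d(x_2,C_1)\}$, where $d(x,C)=\inf_{c\in C}d(x,c)$. Fuzzy sets: for $u:X\to\mathbb{I}$ set $u_\alpha=\{x: u(x)\ge\alpha\}$ for $\alpha\in(0,1]$ and $u_0=\overline{\{x:u(x)>0\}}$. $\mathcal{F}(X)$ (normal fuzzy sets) is the set of all upper-semicontinuous $u:X\to\mathbb{I}$ such that $u_0$ is compact and $u_1$ is non-empty. The Zadeh extension of a continuous $f:X\to X$ is $\hat f:\mathcal{F}(X)\to\mathcal{F}(X)$, $[\hat f(u)](x)=\sup\{u(y): y\in f^{-1}(\{x\})\}$ if $f^{-1}(\{x\})\neq\varnothing$ and $[\hat f(u)](x)=0$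 otherwise (it is well defined). Metrics on $\mathcal{F}(X)$: $d_\infty(u,v)=\sup_{\alpha\in\mathbb{I}}d_H(u_\alpha,v_\alpha)$; the Skorokhod metric $d_0(u,v)$ is the infimum of all $\varepsilon>0$ for which there is a strictly increasing homeomorphism $\xi:\mathbb{I}\to\mathbb{I}$ with $\sup_{\alpha\in\mathbb{I}}|\xi(\alpha)-\alpha|\le\varepsilon$ and $d_\infty(u,\xi\circ v)\le\varepsilon$. On $X\times\mathbb{I}$ put $\overline d((x,\alpha),(y,\beta))=\max\{d(x,y),|\alpha-\beta|\}$, with Hausdorff distance $\overline d_H$. Let $\mathrm{end}(u)=\{(x,\alpha)\in X\times\mathbb{I}: u(x)\ge\alpha\}$ and $\mathrm{send}(u)=\mathrm{end}(u)\cap(u_0\times\mathbb{I})$. The endograph metric is $d_E(u,v)=\overline d_H(\mathrm{end}(u),\mathrm{end}(v))$ and the sendograph metric is $d_S(u,v)=\overline d_H(\mathrm{send}(u),\mathrm{send}(v))$. The map $\hat f$ is continuous for each of these metrics. A dynamical system $(Y,g)$ (a continuous map $g:Y\to Y$ on a metric space $(Y,r)$) is called: contractive if there is $\lambda\in[0,1)$ with $r(g(x),g(y))\le\lambda r(x,y)$ for all $x,y\in Y$; expansive if there is $\lambda>1$ with $r(g(x),g(y))\ge\lambda r(x,y)$ for all $x,y\in Y$; expanding if there are $\varepsilon>0$ and $\lambda>1$ with $r(g(x),g(y))>\lambda r(x,y)$ for all $x,y\in Y$ with $0<r(x,y)<\varepsilon$; positively expansive if there is $\delta>0$ such that for all distinct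 $x,y\in Y$ there is $n\in\mathbb{N}_0$ with $r(g^n(x),g^n(y))>\delta$. *)

(* Defs.v *)
From HB Require Import structures.
From mathcomp Require Import all_boot all_order all_algebra.
From mathcomp Require Import all_classical all_reals all_analysis.

Set Implicit Arguments.
Unset Strict Implicit.
Unset Printing Implicit Defensive.

Import Order.TTheory GRing.Theory Num.Theory.
Import numFieldNormedType.Exports.

Local Open Scope classical_set_scope.
Local Open Scope ring_scope.

(* The distances below are [\bar R]-valued, so that no supremum or infimum
   takes a default value; they are brought back to [R] in [sendograph_dist]
   and [endograph_dist], where they are finite. *)
Section hausdorff_distance.
Context {R : realType} {T : Type} (d : T -> T -> R).

Definition dist_to_set (x : T) (C : set T) : \bar R :=
  ereal_inf [set (d x c)%:E | c in C].

Definition hausdorff_dist (C1 C2 : set T) : \bar R :=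
  maxe (ereal_sup [set dist_to_set x1 C2 | x1 in C1])
       (ereal_sup [set dist_to_set x2 C1 | x2 in C2]).

End hausdorff_distance.

(* Fuzzy sets are functions into [R]; [normal_fuzzy] requires the values to lie
   in [0, 1]. *)
Section fuzzy_sets.
Context {R : realType} {X : metricType R}.
Implicit Types u : X -> R.

Definition upper_semicontinuous u :=
  forall x a, u x < a -> \forall y \near x, u y < a.

Definition support_closure u : set X := closure [set x | 0 < u x].

Definition level u (alpha : R) : set X :=
  if alpha == 0 then support_closure u else [set x | alpha <= u x].

Definition zadeh (f : X -> X) u (x : X) : R :=
  if `[< f @^-1` [set x] !=set0 >] then sup [set u y | y in f @^-1` [set x]]
  else 0.

End fuzzy_sets.

Record normal_fuzzy (R : realType) (X : metricType R) := NormalFuzzy {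
  fuzzy_fun :> X -> R;
  fuzzy_itv : forall x, 0 <= fuzzy_fun x <= 1;
  fuzzy_usc : upper_semicontinuous fuzzy_fun;
  fuzzy_compact : compact (level fuzzy_fun 0);
  fuzzy_normal : level fuzzy_fun 1 !=set0
}.

Section zadeh_extension.
Context {R : realType} {X : metricType R}.
Implicit Types u : normal_fuzzy X.

Lemma fuzzy_ge0 u x : 0 <= u x. Proof. by have /andP[] := fuzzy_itv u x. Qed.

Lemma fuzzy_le1 u x : u x <= 1. Proof. by have /andP[] := fuzzy_itv u x. Qed.

Lemma fuzzy_closed u a : closed [set x | a <= u x].
Proof.
rewrite -openC openE => x /= /negP; rewrite -ltNge => /(fuzzy_usc (n := u)) H.
by near=> y; apply/negP; rewrite -ltNge; near: y.
Unshelve. all: by end_near. Qed.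

Lemma fuzzy_level_compact u a : 0 < a -> compact [set x | a <= u x].
Proof.
move=> a0; apply: (subclosed_compact (@fuzzy_closed u a) (@fuzzy_compact _ _ u)).
move=> x /= ax; rewrite /level eqxx; apply: subset_closure => /=.
exact: lt_le_trans ax.
Qed.

Variables (f : X -> X) (cf : continuous f) (u : normal_fuzzy X).

Local Notation w := (zadeh f u).

Lemma zadeh_ge y : u y <= w (f y).
Proof.
rewrite /zadeh; case: asboolP => [_|]; last by case; exists y.
apply: ub_le_sup; last by exists y.
by exists 1 => _ [z _ <-]; exact: fuzzy_le1.
Qed.

Lemma zadeh_itv x : 0 <= w x <= 1.
Proof.
rewrite [in X in _ && X]/zadeh; case: asboolP => [[y fy]|nfx].
  have <- : f y = x by [].
  rewrite (le_trans (fuzzy_ge0 u y) (zadeh_ge y)) /=.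
  by apply: ge_sup; [exists (u y), y|move=> _ [z _ <-]; exact: fuzzy_le1].
by rewrite ler01 andbT /zadeh asboolF.
Qed.

Lemma zadeh_attained x a : 0 < a -> a <= w x -> exists2 y, f y = x & a <= u y.
Proof.
move=> a0; rewrite /zadeh; case: asboolP => [[y0 fy0]|_]; last first.
  by rewrite leNgt a0.
set S := [set u y | y in _] => aS.
have hS : has_sup S.
  split; first by exists (u y0), y0.
  by exists 1 => _ [z _ <-]; exact: fuzzy_le1.
pose B (e : R) := [set y | f y = x /\ sup S - e < u y].
pose F := filter_from [set e : R | 0 < e] B.
have FF : ProperFilter F.
  apply: filter_from_proper.
    apply: filter_from_filter; first by exists 1 => /=.
    move=> i j i0 j0; exists (Num.min i j); first by rewrite /= lt_min i0.
    move=> y [fy iy]; split; split=> //; apply: le_lt_trans iy.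
      by rewrite lerD2l lerN2 ge_min lexx.
    by rewrite lerD2l lerN2 ge_min lexx orbT.
  by move=> e e0; have [_ [y fy <-] ?] := sup_adherent e0 hS; exists y.
have FB e : 0 < e -> F (B e) by exists e.
have S0 : 0 < sup S by exact: lt_le_trans aS.
have Fc : F (level u 0).
  exists (sup S) => // y [_]; rewrite subrr => y0'.
  by rewrite /level eqxx; exact: subset_closure.
have [p [_ pc]] := @fuzzy_compact _ _ u F FF Fc.
have clf : closed (f @^-1` [set x]).
  apply: preimage_closed; first by move=> ? _; exact: cf.
  exact/accessible_closed_set1/hausdorff_accessible/metric_hausdorff.
exists p.
  apply: clf => V pV; have [z [[fz _] Vz]] := pc _ _ (FB 1 ltr01) pV.
  by exists z.
apply: le_trans aS _; rewrite leNgt; apply/negP => uS.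
have e0 : 0 < (sup S - u p) / 2 by rewrite divr_gt0 // subr_gt0.
have up : u p < sup S - (sup S - u p) / 2.
  by rewrite ltrBrDr -ltrBrDl ltr_pdivrMr // mulr2n mulrDr mulr1 ltrDl subr_gt0.
have [z [[_ zS] za]] := pc _ _ (FB _ e0) (fuzzy_usc up).
by move: zS; rewrite ltNge ltW.
Qed.

Lemma zadeh_usc : upper_semicontinuous w.
Proof.
move=> x a wa; have a0 : 0 < a by apply: le_lt_trans wa; case/andP: (zadeh_itv x).
have cl : closed [set y | a <= w y].
  have -> : [set y | a <= w y] = f @` [set y | a <= u y].
    apply/seteqP; split=> [y /= /(zadeh_attained a0)[z <- az]|_ [z az <-] /=].
      by exists z.
    exact: le_trans (zadeh_ge z).
  apply: compact_closed; first exact: metric_hausdorff.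
  apply: continuous_compact; last exact: fuzzy_level_compact.
  exact: continuous_subspaceT.
have : open (~` [set y | a <= w y]) by rewrite openC.
rewrite openE => /(_ x) /=; have nwx : ~ a <= w x by apply/negP; rewrite -ltNge.
by move=> /(_ nwx); apply: filterS => y /= /negP; rewrite -ltNge.
Qed.

Lemma zadeh_compact : compact (level w 0).
Proof.
have cK : compact (f @` level u 0).
  by apply: continuous_compact; [exact: continuous_subspaceT|exact: fuzzy_compact].
rewrite {1}/level eqxx; apply: (subclosed_compact _ cK); first exact: closed_closure.
have -> : f @` level u 0 = closure (f @` level u 0).
  by apply/closure_id/(compact_closed (@metric_hausdorff R X)).
apply: closure_subset => x /= wx; have [y fy uy] := zadeh_attained wx (lexx _).
exists y => //; rewrite /level eqxx; apply: subset_closure.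
exact: lt_le_trans wx uy.
Qed.

Lemma zadeh_normal : level w 1 !=set0.
Proof.
have [y] := @fuzzy_normal _ _ u; rewrite /level oner_eq0 => uy.
by exists (f y); exact: le_trans (zadeh_ge y).
Qed.

Definition zadeh_ext : normal_fuzzy X :=
  NormalFuzzy zadeh_itv zadeh_usc zadeh_compact zadeh_normal.

End zadeh_extension.

Section fuzzy_metrics.
Context {R : realType} {X : metricType R}.
Implicit Types u v : X -> R.

Definition level_dist u v : \bar R :=
  ereal_sup [set hausdorff_dist mdist (level u alpha) (level v alpha)
            | alpha in `[0, 1]%classic].

(* [xi] is defined on all of [R], but only its restriction to [0, 1] matters:
   that restriction is an increasing homeomorphism of [0, 1], with inverse
   [zeta]. *)
Definition increasing_homeo01 (xi : R -> R) :=
  exists zeta : R -> R,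
    [/\ {in `[0, 1] &, {homo xi : a b / a < b}},
        {homo xi : a / a \in `[0, 1]} /\ {homo zeta : a / a \in `[0, 1]},
        {in `[0, 1], cancel xi zeta} /\ {in `[0, 1], cancel zeta xi},
        {within `[0, 1], continuous xi} &
        {within `[0, 1], continuous zeta}].

Definition deviation01 (xi : R -> R) : \bar R :=
  ereal_sup [set `|xi alpha - alpha|%:E | alpha in `[0, 1]%classic].

Definition skorokhod_radius u v : set R :=
  [set e | 0 < e /\ exists xi : R -> R,
    [/\ increasing_homeo01 xi,
        (deviation01 xi <= e%:E)%E &
        (level_dist u (xi \o v) <= e%:E)%E]].

Definition prod_dist (p q : X * R) : R :=
  Num.max (mdist p.1 q.1) `|p.2 - q.2|.

Definition endograph u : set (X * R) :=
  [set p | 0 <= p.2 <= 1 /\ p.2 <= u p.1].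

Definition sendograph u : set (X * R) :=
  endograph u `&` (level u 0 `*` `[0, 1]).

End fuzzy_metrics.

Section fuzzy_distances.
Context {R : realType} {X : metricType R}.
Implicit Types u v : normal_fuzzy X.

(* The infimum is taken over a non-empty set, by [skorokhod_radius_neq0]. *)
Definition skorokhod_dist u v : R := inf (skorokhod_radius u v).

Definition sendograph_dist u v : R :=
  fine (hausdorff_dist prod_dist (sendograph u) (sendograph v)).

Definition endograph_dist u v : R :=
  fine (hausdorff_dist prod_dist (endograph u) (endograph v)).

Lemma hausdorff_le (T : Type) (d : T -> T -> R) (C1 C2 : set T) (M : R) :
  (forall x, C1 x -> exists2 c, C2 c & d x c <= M) ->
  (forall x, C2 x -> exists2 c, C1 c & d x c <= M) ->
  (hausdorff_dist d C1 C2 <= M%:E)%E.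
Proof.
move=> H1 H2; rewrite /hausdorff_dist ge_max; apply/andP; split.
  apply: ge_ereal_sup => _ [x Cx <-]; have [c Cc dM] := H1 x Cx.
  by apply: ge_ereal_inf; exists (d x c)%:E; [exists c|rewrite lee_fin].
apply: ge_ereal_sup => _ [x Cx <-]; have [c Cc dM] := H2 x Cx.
by apply: ge_ereal_inf; exists (d x c)%:E; [exists c|rewrite lee_fin].
Qed.

Lemma hausdorff_ge0 (T : Type) (d : T -> T -> R) (C1 C2 : set T) :
  (forall x y, 0 <= d x y) -> C1 !=set0 -> (0 <= hausdorff_dist d C1 C2)%E.
Proof.
move=> d0 [x Cx]; rewrite /hausdorff_dist le_max; apply/orP; left.
apply: le_ereal_sup_tmp; exists (dist_to_set d x C2); first by exists x.
by apply: le_ereal_inf_tmp => _ [c _ <-]; rewrite lee_fin.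
Qed.

Lemma hausdorff_fin (T : Type) (d : T -> T -> R) (C1 C2 : set T) (M : R) :
  (forall x y, 0 <= d x y) -> C1 !=set0 ->
  (forall x, C1 x -> exists2 c, C2 c & d x c <= M) ->
  (forall x, C2 x -> exists2 c, C1 c & d x c <= M) ->
  hausdorff_dist d C1 C2 \is a fin_num.
Proof.
move=> d0 C1n0 H1 H2; rewrite ge0_fin_numE; last exact: hausdorff_ge0.
exact: le_lt_trans (hausdorff_le H1 H2) (ltry _).
Qed.

Lemma level_nonempty u a : a \in `[0, 1] -> level u a !=set0.
Proof.
rewrite in_itv /= => /andP[a0 a1].
have [y] := @fuzzy_normal _ _ u; rewrite /level oner_eq0 /= => uy.
exists y; case: eqP => _ /=; last exact: le_trans a1 uy.
by apply: subset_closure; exact: lt_le_trans ltr01 uy.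
Qed.

Lemma level_sub u a : 0 <= a -> level u a `<=` level u 0.
Proof.
rewrite /level eqxx; have [_ _ //|an0 a_ge0 x ax] := eqVneq a 0.
have a0 : 0 < a by rewrite lt_neqAle eq_sym an0.
by apply: subset_closure; exact: lt_le_trans a0 ax.
Qed.

Lemma prod_dist_ge0 (p q : X * R) : 0 <= prod_dist p q.
Proof. by rewrite /prod_dist le_max mdist_ge0. Qed.

Lemma compact_mdist_bounded (A B : set X) : compact A -> compact B ->
  exists M, forall x y, A x -> B y -> mdist x y <= M.
Proof.
have bdd (K : set X) (p : X) : compact K -> exists M, forall x, K x -> mdist p x <= M.
  move=> cK; have cd : continuous (mdist p : X -> R).
    move=> x; apply/cvgrPdist_le => e e0; near=> y.
    have xy : mdist x y < e.
      near: y; have := nbhsx_ballx x e e0; rewrite ballEmdist.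
      by apply: filterS.
    rewrite ler_norml; apply/andP; split.
      rewrite lerBrDr addrC lerBlDr; apply: le_trans (metric_triangle p x y) _.
      by rewrite lerD2l ltW.
    rewrite lerBlDr addrC; apply: le_trans (metric_triangle p y x) _.
    by rewrite lerD2l metric_sym ltW.
  have := continuous_compact (continuous_subspaceT (A := K) cd) cK.
  move=> /compact_bounded[M [_ /(_ (M + 1))]]; rewrite ltrDl ltr01 => /(_ isT) H.
  exists (M + 1) => x Kx; apply: le_trans (ler_norm _) _; apply: H.
  by exists x.
move=> cA cB; have [[p Ap]|A0] := pselect (A !=set0); last first.
  by exists 0 => x y Ax; case: A0; exists x.
have [M HM] := bdd A p cA; have [N HN] := bdd B p cB.
exists (M + N) => x y Ax By; apply: le_trans (metric_triangle x p y) _.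
by rewrite metric_sym lerD ?HM ?HN.
Unshelve. all: by end_near. Qed.

Lemma levels_bounded u v : exists M, forall x y, level u 0 x -> level v 0 y ->
  mdist x y <= M.
Proof. by apply: compact_mdist_bounded; exact: fuzzy_compact. Qed.

Lemma level_dist_fin_num u v : level_dist u v \is a fin_num.
Proof.
have [M HM] := levels_bounded u v; have I0 : (0 : R) \in `[0, 1].
  by rewrite in_itv /= lexx ler01.
rewrite ge0_fin_numE; last first.
  apply: le_ereal_sup_tmp; exists (hausdorff_dist mdist (level u 0) (level v 0)).
    by exists 0.
  by apply: hausdorff_ge0; [exact: mdist_ge0|exact: level_nonempty].
apply: (@le_lt_trans _ _ M%:E); last exact: ltry.
apply: ge_ereal_sup => _ [a aI <-].
have a0 : 0 <= a by move: aI; rewrite /= in_itv /= => /andP[].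
have [p up] := level_nonempty u aI; have [q vq] := level_nonempty v aI.
apply: hausdorff_le => x lx.
  by exists q => //; apply: HM; exact: level_sub a0 _ _.
by exists p => //; rewrite metric_sym; apply: HM; exact: level_sub a0 _ _.
Qed.

Lemma skorokhod_radius_neq0 u v : skorokhod_radius u v !=set0.
Proof.
have d0 : 0 <= fine (level_dist u v).
  apply: fine_ge0; apply: le_ereal_sup_tmp.
  have I0 : (0 : R) \in `[0, 1] by rewrite in_itv /= lexx ler01.
  exists (hausdorff_dist mdist (level u 0) (level v 0)); first by exists 0.
  by apply: hausdorff_ge0; [exact: mdist_ge0|exact: level_nonempty].
have e0 : 0 < fine (level_dist u v) + 1 by rewrite ltr_wpDl.
exists (fine (level_dist u v) + 1); split=> //; exists id; split.
- have idc : continuous (id : R -> R) by move=> x; exact: cvg_id.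
  by exists id; split; [|split|split|exact: continuous_subspaceT..].
- rewrite /deviation01; apply: ge_ereal_sup => _ [a _ <-]; rewrite subrr normr0 lee_fin; exact: ltW.
- rewrite -[leLHS]fineK; last exact: level_dist_fin_num.
  by rewrite lee_fin lerDl.
Qed.

Lemma sendograph_fin_num u v :
  hausdorff_dist prod_dist (sendograph u) (sendograph v) \is a fin_num.
Proof.
have [M HM] := levels_bounded u v.
have I0 : (0 : R) \in `[0, 1] by rewrite in_itv /= lexx ler01.
have p0 (w : normal_fuzzy X) : exists p, sendograph w (p, 0).
  have [x wx] := @level_nonempty w 0 I0.
  exists x; split; last by split.
  by split=> /=; [rewrite lexx ler01|have /andP[] := fuzzy_itv w x].
have [p up] := p0 u; have [q vq] := p0 v.
have maxM x y (a : R) : mdist x y <= M -> 0 <= a <= 1 ->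
    prod_dist (x, a) (y, 0) <= Num.max M 1.
  move=> xyM /andP[a0 a1]; rewrite /prod_dist /= subr0 ger0_norm //.
  by rewrite ge_max !le_max xyM a1 orbT.
apply: (@hausdorff_fin _ _ _ _ (Num.max M 1)); first exact: prod_dist_ge0.
- by exists (p, 0).
- move=> [x a] [[/= aI _] [/= x0 _]]; exists (q, 0) => //; apply: maxM => //.
  by apply: HM => //; case: vq => _ [].
- move=> [x a] [[/= aI _] [/= x0 _]]; exists (p, 0) => //; apply: maxM => //.
  by rewrite metric_sym; apply: HM => //; case: up => _ [].
Qed.

Lemma endograph_fin_num u v :
  hausdorff_dist prod_dist (endograph u) (endograph v) \is a fin_num.
Proof.
have e0 (w : normal_fuzzy X) x : endograph w (x, 0).
  by split=> /=; [rewrite lexx ler01|have /andP[] := fuzzy_itv w x].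
have d1 x (a : R) : 0 <= a <= 1 -> prod_dist (x, a) (x, 0) <= 1.
  move=> /andP[a0 a1].
  by rewrite /prod_dist /= mdistxx subr0 ger0_norm // ge_max ler01.
apply: (@hausdorff_fin _ _ _ _ 1); first exact: prod_dist_ge0.
- by have [x _] := @fuzzy_normal _ _ u; exists (x, 0).
- by move=> [x a] [/= aI _]; exists (x, 0) => //; exact: d1.
- by move=> [x a] [/= aI _]; exists (x, 0) => //; exact: d1.
Qed.

End fuzzy_distances.

(* Properties of the dynamical system [g] on the set [Y] with distance [r]. *)
Section dynamical_properties.
Context {R : realType} {Y : Type}.
Implicit Types (r : Y -> Y -> R) (g : Y -> Y).

Definition contractive r g :=
  exists2 lambda : R, 0 <= lambda < 1 &
    forall x y, r (g x) (g y) <= lambda * r x y.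

Definition expansive r g :=
  exists2 lambda : R, 1 < lambda &
    forall x y, r (g x) (g y) >= lambda * r x y.

Definition expanding r g :=
  exists epsilon lambda : R, [/\ 0 < epsilon, 1 < lambda &
    forall x y, 0 < r x y < epsilon -> r (g x) (g y) > lambda * r x y].

Definition positively_expansive r g :=
  exists2 delta : R, 0 < delta &
    forall x y, x <> y -> exists n, r (iter n g x) (iter n g y) > delta.

End dynamical_properties.

(* Main.v *)
Require Import Defs.
From mathcomp Require Import all_boot all_order all_algebra.
From mathcomp Require Import all_classical all_reals all_analysis.
From mathcomp Require Import ring lra.

Set Implicit Arguments.
Unset Strict Implicit.
Unset Printing Implicit Defensive.

Import Order.TTheory GRing.Theory Num.Theory.
Import numFieldNormedType.Exports.

Local Open Scope classical_set_scope.
Local Open Scope ring_scope.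

(** Everything is tested on the fuzzy sets [spike p q a], with value [1] at [p],
    a height [0 < a < 1] at [q], and [0] elsewhere.

    The Zadeh extension moves the two points and keeps the height: it sends
    [spike p q a] to [spike (f p) (f q) a] ([zadeh_spike]). When [f p = f q]
    the image is the crisp point [f p], whatever the height. On the other hand
    each of the three distances sees two spikes over the same points, with close
    heights, at distance exactly the difference of the heights: the distance
    between [spike p q a] and [spike p q b], for [a < b], is at most [b - a]
    for all [p] and [q], and it is at least [b - a] as soon as
    [b - a <= mdist p q]. These two bounds are collected in [spike_exact].

    The extension can therefore neither shrink nor enlarge all small distances.
    If [f x] and [f y] differ, the spikes over [x, y] with close heights have
    images exactly as far apart as the difference of heights, while they are at
    most that far apart themselves: no factor below [1] works, so that a
    contractive extension forces [f] to be constant. If [X] has two points [p]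
    and [q], the spikes over [p, q] of close heights are at a positive distance
    [b - a], and all their iterated images remain within [b - a]: this excludes
    expansive, expanding and positively expansive at once. Conversely, a
    constant [f] has a constant extension, and over a one-point space there is
    only one normal fuzzy set.

    The bounds for the two graph distances are read off the graphs
    ([endograph_spike_exact], [sendograph_spike_exact]). For the Skorokhod
    distance, a reparametrization [xi] of [0, 1] turns the height [b] into
    [xi b]. A piecewise linear [xi] with [xi b = a] gives the upper bound. For
    the lower bound ([skorokhod_spike_exact]), either [xi b = a] and [xi] moves
    [b] by [b - a], or the heights still differ, and then some level set is
    [{p, q}] on one side and [{p}] on the other, at distance [mdist p q]. *)

(** * Two-point fuzzy sets and their Zadeh extension *)

Section two_point_fuzzy_sets.
Context {R : realType} {X : metricType R}.
Implicit Types (u v : normal_fuzzy X) (p q x y : X) (a b : R).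

Lemma normal_fuzzy_ext u v : (forall x, u x = v x) -> u = v.
Proof.
case: u v => [u u1 u2 u3 u4] [v v1 v2 v3 v4] /= /funext uv.
by case: _ / uv v1 v2 v3 v4 => *; congr NormalFuzzy; exact: Prop_irrelevance.
Qed.

Definition two_point p q a x : R :=
  if x == p then 1 else if x == q then a else 0.

Lemma two_point_itv p q a : 0 < a < 1 -> forall x, 0 <= two_point p q a x <= 1.
Proof. by move=> a01 x; rewrite /two_point; do 2?case: ifP => _; lra. Qed.

(** Points near [x] and different from [x] avoid both [p] and [q], so that the
    value at [x] is a local maximum. *)
Lemma two_point_usc p q a : 0 < a < 1 -> upper_semicontinuous (two_point p q a).
Proof.
move=> a01 x c xc.
have avoid z : x != z -> \forall y \near x, y != z.
  move=> xz; have cz : open (~` [set z]).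
    rewrite openC; apply: accessible_closed_set1.
    exact/hausdorff_accessible/metric_hausdorff.
  have nz : nbhs x (~` [set z]) by apply: open_nbhs_nbhs; split=> //=; exact/eqP.
  by apply: filterS nz => y /= yz; exact/eqP.
have near_eq z : \forall y \near x, (y == z) -> (x == z).
  have [<-|xz] := eqVneq x z; first exact: nearW.
  by apply: filterS (avoid z xz) => y /negPf ->.
near=> y; apply: le_lt_trans xc.
have yp : (y == p) -> (x == p) by near: y; exact: near_eq.
have yq : (y == q) -> (x == q) by near: y; exact: near_eq.
move: yp yq; rewrite /two_point.
by case: (y == p); case: (y == q); case: (x == p); case: (x == q) => Hp Hq;
  try (by have := Hp isT); try (by have := Hq isT); lra.
Unshelve. all: by end_near. Qed.

Lemma two_point_gt0 p q a : 0 < a -> [set x | 0 < two_point p q a x] = [set p; q].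
Proof.
move=> a0; apply/seteqP; split=> x /=; rewrite /two_point.
  case: eqP => [->|_]; first by left.
  by case: eqP => [->|_]; [right|rewrite ltxx].
by case=> ->; rewrite eqxx //; case: ifP.
Qed.

Lemma two_point_level0 p q a : 0 < a -> level (two_point p q a) 0 = [set p; q].
Proof.
move=> a0; rewrite /level eqxx /support_closure two_point_gt0 //.
apply/esym/closure_id; apply: compact_closed; first exact: metric_hausdorff.
by apply: finite_compact; exact: finite_set2.
Qed.

Lemma two_point_compact p q a : 0 < a < 1 -> compact (level (two_point p q a) 0).
Proof.
move=> /andP[a0 _]; rewrite two_point_level0 //.
by apply: finite_compact; exact: finite_set2.
Qed.

Lemma two_point_normal p q a : level (two_point p q a) 1 !=set0.
Proof. by exists p; rewrite /level oner_eq0 /= /two_point eqxx. Qed.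

Definition spike p q a (a01 : 0 < a < 1) : normal_fuzzy X :=
  NormalFuzzy (@two_point_itv p q a a01) (@two_point_usc p q a a01)
    (@two_point_compact p q a a01) (two_point_normal p q a).

(** The case [f p = f q] is included: the value [1] at [f p] then absorbs the
    height [a]. *)
Lemma zadeh_spike (f : X -> X) (cf : continuous f) p q a (a01 : 0 < a < 1) :
  zadeh_ext cf (spike p q a01) = spike (f p) (f q) a01.
Proof.
apply: normal_fuzzy_ext => x /=; apply/eqP; rewrite eq_le; apply/andP; split.
  have [w0|w0] := leP (zadeh f (two_point p q a) x) 0.
    by apply: le_trans w0 _; case/andP: (@two_point_itv (f p) (f q) a a01 x).
  have [y <-] := @zadeh_attained _ _ f cf (spike p q a01) x _ w0 (lexx _).
  move=> wy; apply: le_trans wy _ => /=; rewrite /two_point.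
  have [->|yp] := eqVneq y p; first by rewrite eqxx.
  have [->|yq] := eqVneq y q; last by do 2?case: ifP => _; lra.
  by rewrite eqxx; case: ifP => _; lra.
have wge y : two_point p q a y <= zadeh f (two_point p q a) (f y).
  exact: (@zadeh_ge _ _ f (spike p q a01)).
have := @zadeh_itv _ _ f (spike p q a01) x => /= /andP[w0 _].
rewrite {1}/two_point.
have [->|_] := eqVneq x (f p).
  by apply: le_trans (wge p); rewrite /two_point eqxx.
have [->|//] := eqVneq x (f q).
by apply: le_trans (wge q); rewrite /two_point eqxx; case: ifP => _; lra.
Qed.

Lemma iter_zadeh_spike (f : X -> X) (cf : continuous f) p q a (a01 : 0 < a < 1) n :
  iter n (zadeh_ext cf) (spike p q a01) = spike (iter n f p) (iter n f q) a01.
Proof. by elim: n => //= n ->; exact: zadeh_spike. Qed.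

Lemma two_point_dist p q a b x : a <= b ->
  `|two_point p q a x - two_point p q b x| <= b - a.
Proof.
by move=> ab; rewrite /two_point; do 2?case: ifP => _; rewrite ler_norml; lra.
Qed.

(** This is the lower bound for the graph distances. The tip [(q, b)] of the
    higher spike is far from the graph of the lower one: above [p] because [p] is
    far from [q], and elsewhere because that graph stays below [a]. *)
Lemma two_point_near p q a b x : 0 <= a < b -> b - a <= mdist p q ->
  forall c, c <= two_point p q a x -> b - a <= prod_dist (q, b) (x, c).
Proof.
move=> ab bpq c; rewrite /two_point /prod_dist /= le_max.
have [-> _|xp ca] := eqVneq x p; first by rewrite metric_sym bpq.
apply/orP; right; apply: le_trans (ler_norm _).
by move: ca; case: ifP => _; lra.
Qed.

End two_point_fuzzy_sets.

(** * The property shared by the three distances *)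

Section spike_exactness.
Context {R : realType} {X : metricType R}.

(** All that the dynamical arguments use of a distance. The upper bound is
    required for [p = q] too, since the images under [f] of distinct points may
    coincide; in the lower bound [b - a <= mdist p q] excludes that case. *)
Record spike_exact (rho : normal_fuzzy X -> normal_fuzzy X -> R) : Prop := {
  spike_refl : forall u, rho u u = 0;
  spike_le : forall p q a b (a01 : 0 < a < 1) (b01 : 0 < b < 1), a < b ->
    rho (spike p q a01) (spike p q b01) <= b - a;
  spike_ge : forall p q a b (a01 : 0 < a < 1) (b01 : 0 < b < 1), a < b ->
    b - a <= mdist p q -> b - a <= rho (spike p q a01) (spike p q b01)
}.

End spike_exactness.

(** * Endograph and sendograph distances *)

Section graphs.
Context {R : realType} {X : metricType R}.
Implicit Types u v : normal_fuzzy X.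

Lemma hausdorff_ge (T : Type) (d : T -> T -> R) (C1 C2 : set T) (M : R) x :
  C2 x -> (forall c, C1 c -> M <= d x c) -> (M%:E <= hausdorff_dist d C1 C2)%E.
Proof.
move=> Cx H; rewrite /hausdorff_dist le_max; apply/orP; right.
apply: le_ereal_sup_tmp; exists (dist_to_set d x C1); first by exists x.
by apply: le_ereal_inf_tmp => _ [c Cc <-]; rewrite lee_fin H.
Qed.

(** A point of the graph of [u] is moved vertically, just enough to fall below
    [v]. Keeping the abscissa is what makes this usable for sendographs. *)
Lemma endograph_near u v (M : R) : (forall x, `|u x - v x| <= M) ->
  forall z, endograph u z ->
  exists2 c, endograph v (z.1, c) & prod_dist z (z.1, c) <= M.
Proof.
move=> uvM [x c] [/= /andP[c0 c1] cu].
have := uvM x; rewrite ler_norml => /andP[_ uv].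
have v0 := fuzzy_ge0 v x.
have [cv|vc] := leP c (v x).
  exists c; first by split=> //=; rewrite c0.
  rewrite /prod_dist /= mdistxx subrr normr0 maxxx.
  exact: le_trans (normr_ge0 _) (uvM x).
exists (v x); first by split=> //=; rewrite v0 fuzzy_le1.
rewrite /prod_dist /= mdistxx ge_max (le_trans (normr_ge0 _) (uvM x)) /=.
by rewrite ler_norml; lra.
Qed.

Lemma endograph_dist_le u v (M : R) :
  (forall x, `|u x - v x| <= M) -> endograph_dist u v <= M.
Proof.
move=> uvM; rewrite -lee_fin /endograph_dist fineK ?endograph_fin_num //.
have near (w1 w2 : normal_fuzzy X) : (forall x, `|w1 x - w2 x| <= M) ->
    forall z, endograph w1 z -> exists2 c, endograph w2 c & prod_dist z c <= M.
  by move=> H z /(endograph_near H)[c ? ?]; exists (z.1, c).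
by apply: hausdorff_le; apply: near => // x; rewrite distrC.
Qed.

(** The sendograph also records the support, which uniform closeness does not
    control; hence the first hypothesis. *)
Lemma sendograph_dist_le u v (M : R) : level u 0 = level v 0 ->
  (forall x, `|u x - v x| <= M) -> sendograph_dist u v <= M.
Proof.
move=> uv0 uvM; rewrite -lee_fin /sendograph_dist fineK ?sendograph_fin_num //.
have near (w1 w2 : normal_fuzzy X) : level w1 0 = level w2 0 ->
    (forall x, `|w1 x - w2 x| <= M) ->
    forall z, sendograph w1 z -> exists2 c, sendograph w2 c & prod_dist z c <= M.
  move=> w0 H z [ez [z0 _]]; have [c ec zc] := endograph_near H ez.
  exists (z.1, c) => //; split=> //; split; first by rewrite -w0.
  by case: ec.
by apply: hausdorff_le; apply: near => // x; rewrite distrC.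
Qed.

Lemma endograph_dist_ge0 u v : 0 <= endograph_dist u v.
Proof.
apply/fine_ge0/hausdorff_ge0; first exact: prod_dist_ge0.
have [x _] := fuzzy_normal u; exists (x, 0).
by split=> /=; [rewrite lexx ler01|exact: fuzzy_ge0].
Qed.

Lemma sendograph_dist_ge0 u v : 0 <= sendograph_dist u v.
Proof.
apply/fine_ge0/hausdorff_ge0; first exact: prod_dist_ge0.
have I0 : (0 : R) \in `[0, 1] by rewrite in_itv /= lexx ler01.
have [x ux] := level_nonempty u I0; exists (x, 0).
by split; split=> //=; rewrite ?lexx ?ler01 ?fuzzy_ge0.
Qed.

Lemma endograph_spike_exact : spike_exact (@endograph_dist R X).
Proof.
constructor=> [u|p q a b a01 b01 ab|p q a b a01 b01 ab abpq].
- apply/eqP; rewrite eq_le endograph_dist_ge0 andbT endograph_dist_le // => x.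
  by rewrite subrr normr0.
- by apply: endograph_dist_le => x; apply: two_point_dist; exact: ltW.
- rewrite -lee_fin /endograph_dist fineK ?endograph_fin_num //.
  apply: (@hausdorff_ge _ _ _ _ _ (q, b)).
    split=> /=; first lra.
    by rewrite /two_point eqxx; case: ifP => _; lra.
  by move=> [x c] [_ /= cx]; apply: two_point_near cx => //; lra.
Qed.

Lemma sendograph_spike_exact : spike_exact (@sendograph_dist R X).
Proof.
constructor=> [u|p q a b a01 b01 ab|p q a b a01 b01 ab abpq].
- apply/eqP; rewrite eq_le sendograph_dist_ge0 andbT sendograph_dist_le // => x.
  by rewrite subrr normr0.
- apply: sendograph_dist_le => [|x]; last by apply: two_point_dist; exact: ltW.
  by rewrite /= !two_point_level0 //; lra.
- rewrite -lee_fin /sendograph_dist fineK ?sendograph_fin_num //.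
  apply: (@hausdorff_ge _ _ _ _ _ (q, b)).
    split; first split=> /=; first lra.
      by rewrite /two_point eqxx; case: ifP => _; lra.
    split; last by rewrite /= in_itv /=; lra.
    by rewrite /= two_point_level0 //; [right|lra].
  by move=> [x c] [[_ /= cx] _]; apply: two_point_near cx => //; lra.
Qed.

End graphs.

(** * The Skorokhod distance *)

Section skorokhod.
Context {R : realType} {X : metricType R}.
Implicit Types u v : normal_fuzzy X.

(** The piecewise linear map through [(0, 0)], [(a, b)] and [(1, 1)]. Adding a
    multiple of the tent function with peak [1] at [a] makes continuity and the
    bound [|b - a|] on the deviation immediate. *)
Definition bend (a b t : R) : R :=
  t + (b - a) * Num.min (t / a) ((1 - t) / (1 - a)).

Lemma bend_left a b t : 0 < a < 1 -> t <= a -> bend a b t = t * (b / a).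
Proof.
move=> a01 ta; rewrite /bend min_l.
  by field; lra.
rewrite ler_pdivrMr; last lra.
rewrite mulrAC ler_pdivlMr; last lra.
nra.
Qed.

Lemma bend_right a b t : 0 < a < 1 -> a <= t ->
  bend a b t = 1 - (1 - t) * ((1 - b) / (1 - a)).
Proof.
move=> a01 ta; rewrite /bend min_r.
  by field; lra.
rewrite ler_pdivrMr; last lra.
rewrite mulrAC ler_pdivlMr; last lra.
nra.
Qed.

Lemma bendK a b : 0 < a < 1 -> 0 < b < 1 -> cancel (bend a b) (bend b a).
Proof.
move=> a01 b01 t; have [ta|/ltW ta] := leP t a.
  have tb : t * (b / a) <= b.
    by rewrite mulrA ler_pdivrMr; [nra|lra].
  by rewrite (bend_left b a01 ta) bend_left //; field; lra.
have tb : b <= 1 - (1 - t) * ((1 - b) / (1 - a)).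
  rewrite lerBrDr addrC -lerBrDr mulrA ler_pdivrMr; [nra|lra].
by rewrite (bend_right b a01 ta) bend_right //; field; lra.
Qed.

Lemma bend_lt a b : 0 < a < 1 -> 0 < b < 1 -> {homo bend a b : s t / s < t}.
Proof.
move=> a01 b01 s t st.
have l0 : 0 < b / a by rewrite divr_gt0; lra.
have r0 : 0 < (1 - b) / (1 - a) by rewrite divr_gt0; lra.
have ba : b / a * a = b by field; lra.
have ba1 : (1 - b) / (1 - a) * (1 - a) = 1 - b by field; lra.
have [ta|/ltW ta] := leP t a; have [sa|/ltW sa] := leP s a.
- by rewrite !bend_left //; nra.
- lra.
- rewrite (bend_right b a01 ta) (bend_left b a01 sa).
  set l := b / a in l0 ba *; set r := (1 - b) / (1 - a) in r0 ba1 *.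
  (* the increment is split at the breakpoint, where the slope changes *)
  have : 0 < (t - a) * r + (a - s) * l.
    have [sa'|sa'] := ltP s a; first by apply: ltr_wpDl; nra.
    by apply: ltr_pwDl; nra.
  by nra.
- by rewrite !bend_right //; nra.
Qed.

Lemma bend0 a b : 0 < a < 1 -> bend a b 0 = 0.
Proof. by move=> a01; rewrite bend_left ?mul0r; lra. Qed.

Lemma bend1 a b : 0 < a < 1 -> bend a b 1 = 1.
Proof. by move=> a01; rewrite bend_right ?subrr ?mul0r ?subr0; lra. Qed.

Lemma bend_fix a b : 0 < a < 1 -> bend a b a = b.
Proof. by move=> a01; rewrite bend_left //; field; lra. Qed.

Lemma bend_homo01 a b : 0 < a < 1 -> 0 < b < 1 ->
  {homo bend a b : t / t \in `[0, 1]}.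
Proof.
move=> a01 b01 t; rewrite !in_itv /= => /andP[t0 t1].
have mono := ltW_homo (bend_lt a01 b01).
by rewrite -[X in X <= _](bend0 b a01) -[X in _ && (_ <= X)](bend1 b a01) !mono.
Qed.

Lemma bend_continuous a b : continuous (bend a b).
Proof.
move=> t; rewrite /bend; apply: cvgD; first exact: cvg_id.
apply: cvgM; first exact: cvg_cst.
have cl : {for t, continuous (fun t : R => t / a)}.
  by apply: cvgM; [exact: cvg_id|exact: cvg_cst].
have cr : {for t, continuous (fun t : R => (1 - t) / (1 - a))}.
  apply: cvgM; last exact: cvg_cst.
  by apply: cvgB; [exact: cvg_cst|exact: cvg_id].
exact: (continuous_min cl cr).
Qed.

Lemma bend_homeo a b : 0 < a < 1 -> 0 < b < 1 -> increasing_homeo01 (bend a b).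
Proof.
move=> a01 b01; exists (bend b a); split.
- by move=> s t _ _; exact: bend_lt.
- by split; exact: bend_homo01.
- by split=> t _; exact: bendK.
- exact/continuous_subspaceT/bend_continuous.
- exact/continuous_subspaceT/bend_continuous.
Qed.

Lemma bend_deviation a b : 0 < a < 1 ->
  (deviation01 (bend a b) <= `|b - a|%:E)%E.
Proof.
move=> a01; apply: ge_ereal_sup => _ [t /= + <-]; rewrite in_itv /= => t01.
rewrite lee_fin /bend [_ + _ - _]addrAC subrr add0r normrM ler_piMr //.
rewrite ger0_norm; last by rewrite le_min !divr_ge0; lra.
have [ta|/ltW ta] := leP t a; rewrite ge_min ?ler_pdivrMr ?mul1r; lra.
Qed.

Lemma homeo01_end (xi : R -> R) : increasing_homeo01 xi -> xi 0 = 0 /\ xi 1 = 1.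
Proof.
move=> [zeta [lt [xiI zetaI] [_ zetaK] _ _]].
have I0 : (0 : R) \in `[0, 1] by rewrite in_itv /= lexx ler01.
have I1 : (1 : R) \in `[0, 1] by rewrite in_itv /= lexx ler01.
have xi0 := xiI _ I0; have xi1 := xiI _ I1.
have z0 := zetaI _ I0; have z1 := zetaI _ I1.
have k0 := zetaK _ I0; have k1 := zetaK _ I1.
move: xi0 xi1; rewrite !in_itv /= => xi0 xi1.
split; apply/eqP.
  have [e|n] := eqVneq (zeta 0) 0; first by rewrite -{1}e k0.
  have := lt _ _ I0 z0; rewrite k0; move: z0; rewrite in_itv /= => z0.
  by rewrite lt_neqAle eq_sym n; lra.
have [e|n] := eqVneq (zeta 1) 1; first by rewrite -{1}e k1.
have := lt _ _ z1 I1; rewrite k1; move: z1; rewrite in_itv /= => z1.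
by rewrite lt_neqAle n; lra.
Qed.

(** Reparametrizing the values only changes the height, since [0] and [1] are
    fixed. *)
Lemma homeo01_two_point (xi : R -> R) (p q : X) b : increasing_homeo01 xi ->
  xi \o two_point p q b = two_point p q (xi b).
Proof.
move=> /homeo01_end[xi0 xi1]; apply: funext => x /=.
by rewrite /two_point; do 2?case: ifP.
Qed.

Lemma hausdorff_refl (C : set X) : (hausdorff_dist mdist C C <= 0)%E.
Proof. by apply: hausdorff_le => x Cx; exists x => //; rewrite mdistxx. Qed.

Lemma level_dist_refl (u : X -> R) : (level_dist u u <= 0)%E.
Proof. by apply: ge_ereal_sup => _ [a _ <-]; exact: hausdorff_refl. Qed.

Lemma two_point_level (p q : X) a c : 0 < c <= 1 ->
  level (two_point p q a) c = if c <= a then [set p; q] else [set p].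
Proof.
move=> c01; rewrite /level gt_eqF; last lra.
apply/seteqP; split=> x /=; rewrite /two_point.
  case: eqP => [->|_]; first by case: ifP => //; left.
  by case: eqP => [->|_]; [move=> ->; right|lra].
case: ifP => [ca [->|->]|_ ->]; rewrite ?eqxx; try lra.
by case: ifP => _ //; lra.
Qed.

Lemma level_distC (u v : X -> R) : level_dist u v = level_dist v u.
Proof.
by rewrite /level_dist; congr ereal_sup; apply: eq_imagel => a _; exact: maxC.
Qed.

(** At the level of the greater height one level set is [{p, q}] and the other
    one is [{p}]. *)
Lemma two_point_level_dist (p q : X) a b : 0 < a <= 1 -> 0 < b <= 1 -> a != b ->
  ((mdist p q)%:E <= level_dist (two_point p q a) (two_point p q b))%E.
Proof.
wlog ab : a b / a < b => [H|] a01 b01 anb.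
  have [ab|ba] := ltP a b; first exact: H.
  rewrite level_distC; apply: H => //; last by rewrite eq_sym.
  by rewrite lt_neqAle eq_sym anb.
apply: le_ereal_sup_tmp.
exists (hausdorff_dist mdist (level (two_point p q a) b)
                             (level (two_point p q b) b)).
  by exists b => //=; rewrite in_itv /=; lra.
rewrite !two_point_level // lexx [b <= a]leNgt ab /=.
apply: (@hausdorff_ge _ _ _ _ _ _ q); first by right.
by move=> _ ->; rewrite metric_sym.
Qed.

Lemma skorokhod_dist_le u v (xi : R -> R) (M : R) : increasing_homeo01 xi ->
  (deviation01 xi <= M%:E)%E -> u = xi \o v :> (X -> R) -> 0 <= M ->
  skorokhod_dist u v <= M.
Proof.
move=> hxi dxi uv M0; apply/ler_addgt0Pr => e e0.
apply: ge_inf; first by exists 0 => r [/ltW].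
split; first lra.
exists xi; split=> //.
  by apply: le_trans dxi _; rewrite lee_fin; lra.
rewrite -uv; apply: le_trans (level_dist_refl u) _; rewrite lee_fin; lra.
Qed.

Lemma skorokhod_dist_ge0 u v : 0 <= skorokhod_dist u v.
Proof.
by apply: lb_le_inf; [exact: skorokhod_radius_neq0|move=> r [/ltW]].
Qed.

(** The reparametrization of [0, 1] which carries the height [b] to [a] makes the
    level sets agree. Any other one leaves two different heights, hence level
    sets at distance at least [mdist p q]. *)
Lemma skorokhod_spike_exact : spike_exact (@skorokhod_dist R X).
Proof.
have idh : increasing_homeo01 (id : R -> R).
  have idc : continuous (id : R -> R) by move=> x; exact: cvg_id.
  by exists id; split; [|split|split|exact: continuous_subspaceT..].
constructor=> [u|p q a b a01 b01 ab|p q a b a01 b01 ab abpq].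
- apply/eqP; rewrite eq_le skorokhod_dist_ge0 andbT.
  apply: (skorokhod_dist_le idh) => //.
  by apply: ge_ereal_sup => _ [a _ <-]; rewrite subrr normr0.
- have hb := bend_homeo b01 a01.
  apply: (skorokhod_dist_le hb); last lra.
    by rewrite (_ : b - a = `|a - b|) ?bend_deviation // distrC ger0_norm; lra.
  by rewrite /= homeo01_two_point // bend_fix.
- apply: lb_le_inf; first exact: skorokhod_radius_neq0.
  move=> r [r0 [xi [hxi dxi lxi]]].
  have bI : b \in `[0, 1] by rewrite in_itv /=; lra.
  have [xba|xba] := eqVneq a (xi b).
    rewrite -lee_fin; apply: le_trans dxi; apply: ereal_sup_ubound.
    by exists b => //; rewrite -xba distrC ger0_norm //; lra.
  rewrite -lee_fin; apply: le_trans lxi.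
  rewrite /= homeo01_two_point //; apply: (@le_trans _ _ (mdist p q)%:E).
    by rewrite lee_fin.
  apply: two_point_level_dist => //; first lra.
  have [xi0 _] := homeo01_end hxi.
  have [_ [lt [xiI _] _ _ _]] := hxi.
  have I0 : (0 : R) \in `[0, 1] by rewrite in_itv /= lexx ler01.
  have := xiI _ bI; rewrite in_itv /= => /andP[_ ->]; rewrite andbT -[ltLHS]xi0.
  by apply: lt => //; lra.
Qed.

End skorokhod.

(** * Dynamics of the Zadeh extension *)

Section dynamics.
Context {R : realType} {X : metricType R}.
Variables (f : X -> X) (cf : continuous f).
Variables (rho : normal_fuzzy X -> normal_fuzzy X -> R) (E : spike_exact rho).

Lemma small_heights (m : R) : 0 < m ->
  exists a b : R, [/\ 0 < a < 1, 0 < b < 1, a < b & b - a < m].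
Proof.
move=> m0; exists (2^-1), (2^-1 + Num.min (4^-1) (m / 2)).
have h0 : 0 < Num.min (4^-1) (m / 2) by rewrite lt_min; apply/andP; split; lra.
have h1 : Num.min (4^-1) (m / 2) <= 4^-1 by rewrite ge_min lexx.
have h2 : Num.min (4^-1) (m / 2) <= m / 2 by rewrite ge_min lexx orbT.
by split; lra.
Qed.

Lemma zadeh_const (c : X) (u : normal_fuzzy X) : (forall x, f x = c) ->
  forall x, zadeh f u x = if x == c then 1 else 0.
Proof.
move=> fc x; have [->|xc] := eqVneq x c; last first.
  rewrite /zadeh asboolF // => -[y /=].
  by rewrite fc => /esym/eqP; rewrite (negPf xc).
have /andP[_ w1] := zadeh_itv f u c; apply/eqP; rewrite eq_le w1 /=.
have [y] := fuzzy_normal u; rewrite /level oner_eq0 /= => uy.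
by apply: le_trans uy _; rewrite -(fc y); exact: zadeh_ge.
Qed.

(** Where [f] separates two points, its extension does not bring the spikes over
    them closer, provided that the heights are closer than the images of the
    points. *)
Lemma contractive_zadeh (x0 : X) :
  contractive rho (zadeh_ext cf) <-> exists c, forall x, f x = c.
Proof.
split=> [[l l01 lip]|[c fc]]; last first.
  exists 0 => [|u v]; first by rewrite lexx ltr01.
  rewrite mul0r (_ : zadeh_ext cf u = zadeh_ext cf v) ?(spike_refl E) //.
  by apply: normal_fuzzy_ext => x; rewrite /= !(zadeh_const _ fc).
exists (f x0) => x; apply/eqP; apply: contrapT => /negP fxx0.
have m0 : 0 < mdist (f x) (f x0) by rewrite mdist_gt0.
have [a [b [a01 b01 ab abm]]] := small_heights m0.
have := lip (spike x x0 a01) (spike x x0 b01); rewrite !zadeh_spike.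
have := spike_ge E a01 b01 ab (ltW abm).
have := spike_le E x x0 a01 b01 ab.
by nra.
Qed.

(** All iterated images of two spikes over [p, q] stay within the difference of
    the heights, which can be taken arbitrarily small, and which is the initial
    distance once the heights are closer than [p] and [q]. *)
Lemma not_expansive_zadeh (p q : X) : p != q ->
  [/\ ~ expansive rho (zadeh_ext cf), ~ expanding rho (zadeh_ext cf) &
      ~ positively_expansive rho (zadeh_ext cf)].
Proof.
rewrite -mdist_gt0 => pq0; split.
- move=> [l l1 H]; have [a [b [a01 b01 ab abpq]]] := small_heights pq0.
  have := H (spike p q a01) (spike p q b01); rewrite !zadeh_spike.
  have := spike_le E (f p) (f q) a01 b01 ab.
  have := spike_ge E a01 b01 ab (ltW abpq).
  by nra.
- move=> [e [l [e0 l1 H]]].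
  have m0 : 0 < Num.min e (mdist p q) by rewrite lt_min e0.
  have [a [b [a01 b01 ab]]] := small_heights m0; rewrite lt_min => /andP[abe abpq].
  have := H (spike p q a01) (spike p q b01); rewrite !zadeh_spike.
  have le1 := spike_le E (f p) (f q) a01 b01 ab.
  have le2 := spike_le E p q a01 b01 ab.
  have ge2 := spike_ge E a01 b01 ab (ltW abpq).
  have re : 0 < rho (spike p q a01) (spike p q b01) < e by lra.
  by move=> /(_ re); nra.
- move=> [d d0 H].
  have m0 : 0 < Num.min d (mdist p q) by rewrite lt_min d0.
  have [a [b [a01 b01 ab]]] := small_heights m0; rewrite lt_min => /andP[abd abpq].
  have [|n] := H (spike p q a01) (spike p q b01).
    move=> eab; have := spike_ge E a01 b01 ab (ltW abpq).
    by rewrite eab (spike_refl E); lra.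
  rewrite !iter_zadeh_spike.
  by have := spike_le E (iter n f p) (iter n f q) a01 b01 ab; lra.
Qed.

Lemma expansive_singleton (P : (normal_fuzzy X -> normal_fuzzy X -> R) ->
              (normal_fuzzy X -> normal_fuzzy X) -> Prop) (x0 : X) :
  [set expansive; expanding; positively_expansive] P ->
  [set: X] = [set x0] -> P rho (zadeh_ext cf).
Proof.
move=> PP X1.
have allx x : x = x0 by have : [set: X] x by []; rewrite X1.
have one (u v : normal_fuzzy X) : u = v.
  have at1 (w : normal_fuzzy X) : w x0 = 1.
    have [y] := fuzzy_normal w; rewrite /level oner_eq0 /= (allx y) => w1.
    by apply/eqP; rewrite eq_le w1 fuzzy_le1.
  by apply: normal_fuzzy_ext => x; rewrite (allx x) !at1.
have rho0 u v : rho u v = 0 by rewrite (one u v) (spike_refl E).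
case: PP => [[->|->]|->].
- by exists 2 => [|u v]; [lra|rewrite !rho0 mulr0].
- by exists 1, 2; split=> [||u v]; [lra|lra|rewrite !rho0 ltxx].
- by exists 1 => // u v; case; exact: one.
Qed.

End dynamics.

Theorem theorem3p1 (R : realType) (X : metricType R) (X0 : [set: X] !=set0)
    (f : X -> X) (cf : continuous f) :
  (forall rho : normal_fuzzy X -> normal_fuzzy X -> R,
     [set skorokhod_dist; sendograph_dist; endograph_dist] rho ->
     contractive rho (zadeh_ext cf) <-> (exists c, forall x, f x = c)) /\
  (forall rho : normal_fuzzy X -> normal_fuzzy X -> R,
     [set skorokhod_dist; sendograph_dist; endograph_dist] rho ->
   forall P : (normal_fuzzy X -> normal_fuzzy X -> R) ->
              (normal_fuzzy X -> normal_fuzzy X) -> Prop,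
     [set expansive; expanding; positively_expansive] P ->
     P rho (zadeh_ext cf) <-> (exists x, [set: X] = [set x])).
Proof.
have exact_rho rho :
    [set skorokhod_dist; sendograph_dist; endograph_dist] rho -> spike_exact rho.
  case=> [[->|->]|->].
  - exact: skorokhod_spike_exact.
  - exact: sendograph_spike_exact.
  - exact: endograph_spike_exact.
split=> rho /exact_rho E; first by case: X0 => x0 _; exact: contractive_zadeh.
move=> P PP; split=> [Prho|[x]]; last exact: expansive_singleton.
have [x0 _] := X0; exists x0; apply/seteqP; split=> // x _ /=.
apply/eqP; apply: contrapT => /negP xx0.
have [n1 n2 n3] := not_expansive_zadeh cf E xx0.
by case: PP Prho => [[->|->]|->].
Qed.
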